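(* For every integer $n\geq 6$, the cycle graph $C_n$ on $n$ vertices has an independent fault-tolerant resolving set, and its independent fault-tolerant resolving number is $\mathrm{ifr}(C_n)=3$.
   Context: Let $\Gamma=(V,E)$ be a non-trivial, undirected, simple, connected graph, and let $d(u,v)$ denote the length of a shortest $u$–$v$ path. A set $R=\{u^1,\dots,u^t\}\subseteq V$ is a resolving set for $\Gamma$ if distinct vertices $u$ of $\Gamma$ have distinct distance tuples $(d(u,u^1),\dots,d(u,u^t))$. A resolving set $R_f$ is fault-tolerant if $R_f\setminus\{u\}$ is also a resolving set for every $u\in R_f$. A set of vertices is independent if no two of its vertices are adjacent. An independent fault-tolerant resolving set is a fault-tolerant resolving set that is independent. When at least one such set exists, the independent fault-tolerant resolving number $\mathrm{ifr}(\Gamma)$ is the minimum cardinality of an independent fault-tolerant resolving set of $\Gamma$; otherwise $\mathrm{ifr}(\Gamma)$ is not defined. *)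

(* Defs.v *)
From mathcomp Require Import all_boot.

Set Implicit Arguments.
Unset Strict Implicit.
Unset Printing Implicit Defensive.

Record sgraph := SGraph {
  vertex :> finType;
  adj : rel vertex;
  adj_sym : symmetric adj;
  adj_irr : irreflexive adj }.

Definition connected_graph (G : sgraph) : Prop :=
  forall u v : G, connect (@adj G) u v.

Definition has_walk (G : sgraph) (u v : G) (k : nat) : bool :=
  [exists p : k.-tuple G, path (@adj G) u p && (last u p == v)].

(* A shortest walk is a path, so its length is less than #|G|; if there is no  *)
(* walk from u to v, the value is the dummy #|G|.                              *)
Definition gdist (G : sgraph) (u v : G) : nat :=
  find (has_walk u v) (iota 0 #|G|).

Definition dist_tuple (G : sgraph) (R : {set G}) (u : G) : #|R|.-tuple nat :=
  [tuple gdist u (enum_val i) | i < #|R|].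

Definition resolving (G : sgraph) (R : {set G}) : bool :=
  injectiveb (dist_tuple R).

Definition fault_tolerant_resolving (G : sgraph) (R : {set G}) : bool :=
  resolving R && [forall u in R, resolving (R :\ u)].

Definition independent (G : sgraph) (R : {set G}) : bool :=
  [forall u in R, forall v in R, ~~ adj u v].

Definition indep_ftr (G : sgraph) (R : {set G}) : bool :=
  independent R && fault_tolerant_resolving R.

(* None when no independent fault-tolerant resolving set exists. *)
Definition ifr (G : sgraph) : option nat :=
  if [pick R : {set G} | indep_ftr R] is Some R0
  then Some #|[arg min_(R < R0 | indep_ftr R) #|R|]|
  else None.

(* ordS is the cyclic successor i |-> i.+1 %% n. The guard u != v only matters *)
(* for n = 1, where it removes the loop.                                       *)
Definition cycle_adj (n : nat) : rel 'I_n :=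
  fun u v => (u != v) && ((ordS u == v) || (ordS v == u)).

Lemma cycle_adj_sym (n : nat) : symmetric (@cycle_adj n).
Proof. by move=> u v; rewrite /cycle_adj eq_sym orbC. Qed.

Lemma cycle_adj_irr (n : nat) : irreflexive (@cycle_adj n).
Proof. by move=> u; rewrite /cycle_adj eqxx. Qed.

Definition cycle_graph (n : nat) : sgraph :=
  SGraph (@cycle_adj_sym n) (@cycle_adj_irr n).

Lemma cycle_graph_connected (n : nat) : connected_graph (cycle_graph n).
Proof.
case: n => [[] //|n] u v.
have from0 : forall k (w : 'I_n.+1),
    w = k :> nat -> connect (@cycle_adj n.+1) ord0 w.
  elim=> [|k IHk] w wk; first by rewrite (_ : w = ord0) //; apply: val_inj.
  have ltk : k < n.+1 by rewrite ltnW // -wk.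
  apply: connect_trans (IHk (Ordinal ltk) erefl) (connect1 _).
  apply/andP; split; first by rewrite -val_eqE /= wk neq_ltn ltnSn.
  by apply/orP; left; rewrite -val_eqE /= modn_small -wk.
have symC : connect_sym (@cycle_adj n.+1).
  exact/sym_connect_sym/cycle_adj_sym.
by apply: (@connect_trans _ _ ord0); [rewrite symC|]; apply: from0.
Qed.

Lemma ifrP (G : sgraph) (k : nat) :
  ifr G = Some k <->
  (exists2 R : {set G}, indep_ftr R & #|R| = k) /\
  (forall R : {set G}, indep_ftr R -> k <= #|R|).
Proof.
rewrite /ifr; case: pickP => [R0 R0P | noR]; last first.
  by split=> // -[[R RP _] _]; move: (noR R); rewrite RP.
case: arg_minnP => // R RP Rmin; split=> [[<-] | [[S SP <-] Smin]].
  by split=> //; exists R.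
by congr Some; apply/eqP; rewrite eqn_leq Rmin // Smin.
Qed.

(* Main.v *)
Require Import Defs.
From mathcomp Require Import all_boot.
From mathcomp Require Import zify.

(** Two vertices of a cycle resolve it exactly when they are distinct and not
    antipodal, whereas a single vertex never does, its two neighbours being
    equidistant from it. Deleting a vertex from a fault-tolerant resolving set
    thus leaves at least two vertices. Conversely, three pairwise non-adjacent
    and pairwise non-antipodal vertices suffice: {0, 2, 4} works unless n = 8,
    where 0 and 4 are antipodal, and then {0, 2, 5} does. *)

(** Since [D] drops by at most one along an edge, no walk to [v] is shorter than [D u]; since some
    edge always lowers it, descending gives a walk of exactly that length. The bound by [#|G|] keeps
    [D u] inside the range that [gdist] searches. *)
Lemma gdist_eq (G : sgraph) (v : G) (D : G -> nat) :
    (forall u, D u = 0 <-> u = v) ->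
    (forall u w, adj u w -> D u <= (D w).+1) ->
    (forall u k, D u = k.+1 -> exists2 w, adj u w & D w = k) ->
    (forall u, D u < #|G|) ->
  forall u, gdist u v = D u.
Proof.
move=> D0 Dstep Dpred Dlt u.
have short (p : seq G) : forall x, path (@adj G) x p -> last x p = v ->
    D x <= size p.
  elim: p => [|y p IHp] x /=; first by move=> _ /D0 ->.
  by case/andP=> /Dstep Dxy pP lastp; apply: leq_trans Dxy _; apply: IHp.
have walk : has_walk u v (D u).
  suff [p [/eqP sp pP lp]] :
      exists p, [/\ size p = D u, path (@adj G) u p & last u p = v].
    by apply/existsP; exists (Tuple sp); rewrite /= pP lp eqxx.
  move Du: (D u) => k; elim: k u Du => [|k IHk] u Du.
    by exists [::]; split => //; apply/D0.
  have [w uw /IHk[p [sp pP lp]]] := Dpred _ _ Du.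
  by exists (w :: p); rewrite /= sp uw.
rewrite /gdist; set s := iota 0 #|G|.
have has_s : has (has_walk u v) s.
  by apply/hasP; exists (D u) => //; rewrite mem_iota /= add0n.
have find_lt : find (has_walk u v) s < #|G|.
  by move: has_s; rewrite has_find size_iota.
apply/eqP; rewrite eqn_leq; apply/andP; split.
  rewrite leqNgt; apply/negP => /(before_find 0).
  by rewrite nth_iota ?add0n ?walk // Dlt.
have := nth_find 0 has_s; rewrite nth_iota // add0n.
by case/existsP=> p /andP[pP /eqP /(short _ _ pP)]; rewrite size_tuple.
Qed.

Lemma resolvingP (G : sgraph) (R : {set G}) :
  reflect (forall u v, {in R, forall w, gdist u w = gdist v w} -> u = v)
          (resolving R).
Proof.
apply: (iffP (injectiveP _)) => injR u v eq_uv; apply: injR.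
  by apply: eq_from_tnth => i; rewrite !tnth_mktuple eq_uv ?enum_valP.
move=> w wR; have := congr1 (fun t => tnth t (enum_rank_in wR w)) eq_uv.
by rewrite !tnth_mktuple enum_rankK_in.
Qed.

Lemma resolvingS (G : sgraph) (R S : {set G}) :
  R \subset S -> resolving R -> resolving S.
Proof.
move=> /subsetP sRS /resolvingP resR; apply/resolvingP => u v eq_uv.
by apply: resR => w /sRS; apply: eq_uv.
Qed.

(** Trades the modulus for a case split at the wrap-around, which suits linear arithmetic. *)
Lemma val_ordS (n : nat) (u : 'I_n) :
  ordS u = (if u.+1 == n then 0 else u.+1) :> nat.
Proof.
rewrite /=; case: eqP => [->|]; first by rewrite modnn.
by move=> un; rewrite modn_small //; have := ltn_ord u; lia.
Qed.

(** With truncated subtraction, [(a - b) + (b - a)] is the absolute difference, so the minimum is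
    over the two arcs joining [a] and [b]. *)
Definition cycle_dist (n a b : nat) : nat :=
  minn ((a - b) + (b - a)) (n - ((a - b) + (b - a))).

Lemma cycle_distC (n a b : nat) : cycle_dist n a b = cycle_dist n b a.
Proof. by rewrite /cycle_dist addnC. Qed.

Lemma cycle_distxx (n a : nat) : cycle_dist n a a = 0.
Proof. by rewrite /cycle_dist subnn min0n. Qed.

Lemma cycle_dist_le (n a b : nat) :
  a <= b -> cycle_dist n a b = minn (b - a) (n - (b - a)).
Proof. by rewrite /cycle_dist -subn_eq0 => /eqP ->. Qed.

Lemma cycle_adjE (n : nat) (u v : 'I_n) :
  3 <= n -> cycle_adj u v = (cycle_dist n u v == 1).
Proof.
move=> n3; rewrite /cycle_adj -!(inj_eq (@ord_inj n)) !val_ordS /cycle_dist.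
have := ltn_ord u; have := ltn_ord v.
by case: (u.+1 =P n) => ?; case: (v.+1 =P n) => ?; lia.
Qed.

Lemma gdist_cycle (n : nat) (u v : cycle_graph n) :
  3 <= n -> gdist u v = cycle_dist n u v.
Proof.
move=> n3; apply: (@gdist_eq (cycle_graph n) v (fun w : 'I_n => cycle_dist n w v)).
- move=> w; have := ltn_ord w; have := ltn_ord v; rewrite /cycle_dist => vn wn.
  by split=> [d0|->]; [apply: val_inj => /=; lia | lia].
- move=> x w; rewrite /= cycle_adjE // => /eqP; rewrite /cycle_dist.
  by have := ltn_ord x; have := ltn_ord w; have := ltn_ord v; lia.
- move=> x k Dx.
  (* A shortest arc from [x] to [v] leaves through one of the two neighbours: if the successor is
     not nearer, the predecessor is. *)
  have [DS|DS] := eqVneq (cycle_dist n (ordS x) v) k.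
    exists (ordS x) => //; rewrite /= cycle_adjE // val_ordS /cycle_dist.
    by have := ltn_ord x; case: (x.+1 =P n); lia.
  have adj_pred : cycle_dist n x (ord_pred x) = 1.
    rewrite -{1}(ord_predK x) val_ordS /cycle_dist.
    by have := ltn_ord (ord_pred x); case: ((ord_pred x).+1 =P n); lia.
  exists (ord_pred x); first by rewrite /= cycle_adjE // adj_pred.
  have := val_ordS n (ord_pred x); rewrite ord_predK.
  move: DS Dx; rewrite val_ordS /cycle_dist.
  have := ltn_ord (ord_pred x); have := ltn_ord x; have := ltn_ord v.
  move: (nat_of_ord (ord_pred x)) => p.
  by case: (x.+1 =P n) => ?; case: (p.+1 =P n) => ?; lia.
- by move=> x; rewrite card_ord /cycle_dist; have := ltn_ord x; lia.
Qed.

(* v is either u itself or its mirror image in the axis through a. *)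
Lemma cycle_dist_eq (n a u v : nat) :
    a < n -> u < n -> v < n -> cycle_dist n u a = cycle_dist n v a ->
  [\/ u = v, u + v = 2 * a, u + v = 2 * a + n | u + v + n = 2 * a].
Proof.
rewrite /cycle_dist => an un vn eq_uv.
suff : u = v \/ u + v = 2 * a \/ u + v = 2 * a + n \/ u + v + n = 2 * a.
  by case=> [|[|[|]]] ?; [exact: Or41 | exact: Or42 | exact: Or43 | exact: Or44].
by case: (leqP u a) => ?; case: (leqP v a) => ?; lia.
Qed.

(** If distinct [u] and [v] were not separated, they would be mirror images in the axes through both
    [a] and [b], so [2 * a] and [2 * b] would agree modulo [n], forcing [a] and [b] to be equal or
    antipodal. *)
Lemma resolving_cycle_pair (n : nat) (a b : cycle_graph n) :
    3 <= n -> a != b -> cycle_dist n a b * 2 != n ->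
  resolving [set a; b].
Proof.
move=> n3; rewrite -val_eqE /= => ab dab; apply/resolvingP => u v eq_uv.
have [an bn] : a < n /\ b < n by split; apply: ltn_ord.
have [un vn] : u < n /\ v < n by split; apply: ltn_ord.
have := eq_uv a (set21 a b); have := eq_uv b (set22 a b).
rewrite !gdist_cycle // => /(cycle_dist_eq _ _ _ _ bn un vn) eqb.
move/(cycle_dist_eq _ _ _ _ an un vn) => eqa; apply: val_inj => /=.
by move: ab dab; rewrite /cycle_dist; case: eqa; case: eqb; lia.
Qed.

Lemma cycle_resolving_card (n : nat) (R : {set cycle_graph n}) :
  3 <= n -> resolving R -> 2 <= #|R|.
Proof.
move=> n3 resR; rewrite ltnNge; apply/negP => cardR.
(* Enlarging [R] to a singleton covers the empty set too, as supersets of resolving sets resolve. *)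
have [w sRw] : exists w, R \subset [set w].
  have [->|[w wR]] := set_0Vmem R.
    by exists (Ordinal (ltn_trans (isT : 0 < 2) n3)); apply: sub0set.
  by exists w; apply/subsetP => x xR; rewrite inE (card_le1_eqP cardR x w).
have /resolvingP res_w := resolvingS _ _ _ sRw resR.
(* Both neighbours of [w] are at distance 1 from it, yet they differ as soon as [n] is at least
   3. *)
have : ordS w = ord_pred w.
  apply: res_w => x /set1P ->; rewrite !gdist_cycle //.
  have := val_ordS n (ord_pred w); rewrite ord_predK.
  rewrite val_ordS /cycle_dist.
  have := ltn_ord (ord_pred w); have := ltn_ord w.
  move: (nat_of_ord (ord_pred w)) => p.
  by case: (w.+1 =P n) => ?; case: (p.+1 =P n) => ?; lia.
move/(congr1 (@nat_of_ord n)); have := val_ordS n (ord_pred w).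
rewrite ord_predK val_ordS.
have := ltn_ord (ord_pred w); have := ltn_ord w.
move: (nat_of_ord (ord_pred w)) => p.
by case: (w.+1 =P n) => ?; case: (p.+1 =P n) => ?; lia.
Qed.

Lemma cycle_fault_tolerant_card (n : nat) (R : {set cycle_graph n}) :
  3 <= n -> fault_tolerant_resolving R -> 3 <= #|R|.
Proof.
move=> n3 /andP[resR /forall_inP ftR].
have R2 := cycle_resolving_card _ _ n3 resR.
(* The deletion condition is vacuous on an empty set; that [R] itself resolves supplies a vertex to
   delete. *)
have /card_gt0P[w wR] : 0 < #|R| by apply: ltn_trans R2.
by rewrite (cardsD1 w) wR; apply: cycle_resolving_card (ftR w wR).
Qed.

(** Each pair among the three already resolves, so any single deletion leaves a resolving pair.
    Distances above 1 give both distinctness and independence. *)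
Lemma cycle_triple_indep_ftr (n : nat) (a b c : cycle_graph n) :
    3 <= n ->
    1 < cycle_dist n a b -> 1 < cycle_dist n b c -> 1 < cycle_dist n a c ->
    cycle_dist n a b * 2 != n -> cycle_dist n b c * 2 != n ->
    cycle_dist n a c * 2 != n ->
  indep_ftr [set a; b; c] /\ #|[set a; b; c]| = 3.
Proof.
move=> n3 ab bc ac ab2 bc2 ac2.
have neq (x y : cycle_graph n) : 1 < cycle_dist n x y -> x != y.
  by apply: contraTneq => ->; rewrite cycle_distxx.
have nab := neq _ _ ab; have nbc := neq _ _ bc; have nac := neq _ _ ac.
have resab := resolving_cycle_pair _ _ _ n3 nab ab2.
have resbc := resolving_cycle_pair _ _ _ n3 nbc bc2.
have resac := resolving_cycle_pair _ _ _ n3 nac ac2.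
split; last by rewrite setUC cardsU1 cards2 nab !inE negb_or eq_sym nac eq_sym nbc.
apply/andP; split.
  apply/forall_inP => x xR; apply/forall_inP => y yR; rewrite /= cycle_adjE //.
  move: xR yR; rewrite !inE -!orbA.
  by case/or3P=> /eqP-> /or3P[]/eqP->;
    rewrite ?cycle_distxx // neq_ltn ?ab ?bc ?ac ?orbT //
      cycle_distC ?ab ?bc ?ac orbT.
apply/andP; split; first by apply: resolvingS resab; apply: subsetUl.
apply/forall_inP => x; rewrite !inE -orbA.
case/or3P=> /eqP->; [apply: resolvingS resbc | apply: resolvingS resac
  | apply: resolvingS resab]; apply/subsetP => y; rewrite !inE;
  case/orP=> /eqP->; rewrite ?eqxx ?orbT ?andbT // eq_sym //.
all: by rewrite eq_sym.
Qed.

Theorem proposition4 (n : nat) (hn : 6 <= n) :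
  (exists R : {set cycle_graph n}, indep_ftr R) /\ ifr (cycle_graph n) = Some 3.
Proof.
have n3 : 3 <= n by apply: leq_trans hn.
have lt0 : 0 < n by lia.
have lt2 : 2 < n by lia.
(* From 4 back to 0 the other arc has length [n - 4], at least 2 because [n] is at least 6; both
   arcs have length 4 only for [n = 8]. There 0, 2, 5 have pairwise distances 2, 3, 3, none of them
   4. *)
have ltc : (if n == 8 then 5 else 4) < n by case: eqP; lia.
have [ftR cardR] : let R := [set Ordinal lt0; Ordinal lt2; Ordinal ltc] in
    @indep_ftr (cycle_graph n) R /\ #|R| = 3.
  by apply: cycle_triple_indep_ftr => //=; rewrite cycle_dist_le;
    case: (n =P 8) => //; lia.
split; first by eexists; apply: ftR.
apply/ifrP; split; first by eexists; [apply: ftR | apply: cardR].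
by move=> S /andP[_]; apply: cycle_fault_tolerant_card.
Qed.
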